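(* A functor $F:\mathcal{C}\to\mathcal{D}$ factors as a bireflection followed by a separable functor if and only if it is semiseparable and the associated idempotent natural transformation $e:\mathrm{Id}_{\mathcal{C}}\to\mathrm{Id}_{\mathcal{C}}$ splits. Moreover, any such factorization coincides, up to a category equivalence, with the factorization $F=F_e\circ H$ through the coidentifier $\mathcal{C}_e$: if $F=S\circ N$ with $N:\mathcal{C}\to\mathcal{E}$ a bireflection and $S:\mathcal{E}\to\mathcal{D}$ separable, then the unique functor $N_e:\mathcal{C}_e\to\mathcal{E}$ such that $N_e\circ H=N$ and $S\circ N_e=F_e$ is an equivalence of categories.
   Context: For a functor $F:\mathcal{C}\to\mathcal{D}$ let $\mathcal{F}^F:\mathrm{Hom}_{\mathcal{C}}(-,-)\to\mathrm{Hom}_{\mathcal{D}}(F-,F-)$ be the natural transformation (of functors $\mathcal{C}^{\mathrm{op}}\times\mathcal{C}\to\mathsf{Set}$) with $\mathcal{F}^F_{X,Y}(f)=F(f)$. $F$ is separable if there is a natural transformation $\mathcal{P}^F:\mathrm{Hom}_{\mathcal{D}}(F-,F-)\to\mathrm{Hom}_{\mathcal{C}}(-,-)$ with $\mathcal{P}^F\circ\mathcal{F}^F=\mathrm{Id}$; semiseparable if there is such a $\mathcal{P}^F$ with $\mathcal{F}^F\circ\mathcal{P}^F\circ\mathcal{F}^F=\mathcal{F}^F$. Associated idempotent: for $F$ semiseparable, the associated idempotent natural transformation $e:\mathrm{Id}_{\mathcal{C}}\to\mathrm{Id}_{\mathcal{C}}$ is the unique idempotent natural transformation with $Fe=\mathrm{Id}_F$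 such that for all $f,g:A\to B$ in $\mathcal{C}$, $Ff=Fg$ iff $e_B\circ f=e_B\circ g$; explicitly $e_X=\mathcal{P}^F_{X,X}(\mathrm{Id}_{FX})$. It splits if there are a functor $P:\mathcal{C}\to\mathcal{C}$ and natural transformations $\pi:\mathrm{Id}_{\mathcal{C}}\to P$, $\iota:P\to\mathrm{Id}_{\mathcal{C}}$ with $\iota\circ\pi=e$ and $\pi\circ\iota=\mathrm{Id}_P$. Coidentifier: $\mathcal{C}_e$ has the same objects as $\mathcal{C}$ and $\mathrm{Hom}_{\mathcal{C}_e}(A,B)=\mathrm{Hom}_{\mathcal{C}}(A,B)/\sim$, where $f\sim g$ iff $e_B\circ f=e_B\circ g$. The quotient functor $H:\mathcal{C}\to\mathcal{C}_e$ is the identity on objects and the canonical projection on morphisms. $F_e:\mathcal{C}_e\to\mathcal{D}$ denotes the unique functor with $F_e\circ H=F$ (it acts as $F$ on objects and sends the class of $f$ to $Ff$). A functor $G:\mathcal{D}\to\mathcal{C}$ is a bireflection if it has a left and right adjoint equal, say $L:\mathcal{C}\to\mathcal{D}$, which is fully faithful and satisfies the coherence condition $\gamma\circ\epsilon=\mathrm{Id}_{LG}$, where $\epsilon:LG\to\mathrm{Id}_{\mathcal{D}}$ is the counit of $L\dashv G$ and $\gamma:\mathrm{Id}_{\mathcal{D}}\to LG$ is the unit of $G\dashv L$. ''A bireflection followed by a separable functor'' means $F=S\circ N$ with $N$ a bireflection and $S$ separable. *)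

(* Defs.v *)
From HB Require Import structures.
From mathcomp Require Import all_boot generic_quotient boolp.

Set Implicit Arguments.
Unset Strict Implicit.
Unset Printing Implicit Defensive.

Declare Scope cat_scope.
Delimit Scope cat_scope with cat.
Local Open Scope cat_scope.
Local Open Scope quotient_scope.
Local Obligation Tactic := try by [].

(* Morphisms, functors and natural transformations are compared by Leibniz
   equality; since functional extensionality and proof irrelevance are
   available, this is the usual (strict) equality, see [functor_eq] and
   [nat_trans_eq]. *)
Record category := Category {
  ob :> Type;
  hom : ob -> ob -> Type;
  idm : forall x, hom x x;
  comp : forall x y z, hom y z -> hom x y -> hom x z;
  compA : forall x y z w (h : hom z w) (g : hom y z) (f : hom x y),
    comp h (comp g f) = comp (comp h g) f;
  comp1m : forall x y (f : hom x y), comp (idm y) f = f;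
  compm1 : forall x y (f : hom x y), comp f (idm x) = f }.

Arguments hom {c} x y.
Arguments idm {c} x.
Arguments comp {c x y z} g f.
Notation "g ∘ f" := (comp g f) (at level 40, left associativity) : cat_scope.

Record functor (C D : category) := Functor {
  fob :> C -> D;
  fmap : forall x y : C, hom x y -> hom (fob x) (fob y);
  fmap1 : forall x, fmap (idm x) = idm (fob x);
  fmapM : forall x y z (g : hom y z) (f : hom x y),
    fmap (g ∘ f) = fmap g ∘ fmap f }.

Arguments fmap {C D} F {x y} f : rename.

Record nat_trans (C D : category) (F G : functor C D) := NatTrans {
  nt :> forall x : C, hom (F x) (G x);
  naturality : forall (x y : C) (f : hom x y),
    nt y ∘ fmap F f = fmap G f ∘ nt x }.

Lemma functor_eq (C D : category) (F : functor C D)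
    (m : forall x y : C, hom x y -> hom (F x) (F y)) p q :
  (forall x y f, m x y f = fmap F f) -> @Functor C D F m p q = F.
Proof.
case: F m p q => [o m' p' q'] /= m p q h.
have e : m = m'.
  apply: functional_extensionality_dep => x.
  apply: functional_extensionality_dep => y.
  exact: functional_extensionality_dep.
by subst m; congr Functor; apply: Prop_irrelevance.
Qed.

Lemma nat_trans_eq (C D : category) (F G : functor C D) (a b : nat_trans F G) :
  (forall x, a x = b x) -> a = b.
Proof.
case: a b => [a p] [b q] /= ab.
have e : a = b by exact: functional_extensionality_dep.
by subst b; congr NatTrans; apply: Prop_irrelevance.
Qed.

Program Definition id_functor (C : category) : functor C C :=
  @Functor C C (fun x => x) (fun x y f => f) _ _.

Program Definition comp_functor (A B C : category)
    (G : functor B C) (F : functor A B) : functor A C :=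
  @Functor A C (fun x => G (F x)) (fun x y f => fmap G (fmap F f)) _ _.
Next Obligation. by move=> * /=; rewrite !fmap1. Qed.
Next Obligation. by move=> * /=; rewrite !fmapM. Qed.

Notation "G ∘F F" := (comp_functor G F)
  (at level 40, left associativity) : cat_scope.

Program Definition id_nt (C D : category) (F : functor C D) : nat_trans F F :=
  @NatTrans C D F F (fun x => idm (F x)) _.
Next Obligation. by move=> * /=; rewrite comp1m compm1. Qed.

Program Definition comp_nt (C D : category) (F G H : functor C D)
    (b : nat_trans G H) (a : nat_trans F G) : nat_trans F H :=
  @NatTrans C D F H (fun x => b x ∘ a x) _.
Next Obligation.
by move=> C D F G H b a x y f /=; rewrite -compA naturality !compA naturality.
Qed.

Notation "b ∘N a" := (comp_nt b a)
  (at level 40, left associativity) : cat_scope.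

Program Definition op_cat (C : category) : category :=
  @Category C (fun x y => hom y x) (@idm C) (fun x y z g f => f ∘ g) _ _ _.
Next Obligation. by move=> * /=; rewrite compA. Qed.
Next Obligation. by move=> * /=; rewrite compm1. Qed.
Next Obligation. by move=> * /=; rewrite comp1m. Qed.

Program Definition prod_cat (C D : category) : category :=
  @Category (C * D)%type (fun x y => hom x.1 y.1 * hom x.2 y.2)%type
    (fun x => (idm x.1, idm x.2))
    (fun x y z g f => (g.1 ∘ f.1, g.2 ∘ f.2)) _ _ _.
Next Obligation. by move=> * /=; rewrite !compA. Qed.
Next Obligation. by move=> C D x y [f g]; rewrite !comp1m. Qed.
Next Obligation. by move=> C D x y [f g]; rewrite !compm1. Qed.

Program Definition type_cat : category :=
  @Category Type (fun X Y => X -> Y) (fun X x => x)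
    (fun X Y Z g f x => g (f x)) _ _ _.

Program Definition op_functor (C D : category) (F : functor C D) :
    functor (op_cat C) (op_cat D) :=
  @Functor (op_cat C) (op_cat D) F (fun x y f => fmap F f) _ _.
Next Obligation. by move=> C D F x /=; rewrite fmap1. Qed.
Next Obligation. by move=> C D F x y z g f /=; rewrite fmapM. Qed.

Program Definition prod_functor (A B C D : category)
    (F : functor A C) (G : functor B D) :
    functor (prod_cat A B) (prod_cat C D) :=
  @Functor (prod_cat A B) (prod_cat C D) (fun x => (F x.1, G x.2))
    (fun x y f => (fmap F f.1, fmap G f.2)) _ _.
Next Obligation. by move=> * /=; rewrite !fmap1. Qed.
Next Obligation. by move=> * /=; rewrite !fmapM. Qed.

Program Definition hom_functor (C : category) :
    functor (prod_cat (op_cat C) C) type_cat :=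
  @Functor (prod_cat (op_cat C) C) type_cat (fun p => @hom C p.1 p.2)
    (fun p q u (f : @hom C p.1 p.2) => (u.2 : @hom C p.2 q.2) ∘ f ∘ u.1) _ _.
Next Obligation.
by move=> C x /=; apply: funext => f; rewrite comp1m compm1.
Qed.
Next Obligation. by move=> C x y z g f /=; apply: funext => h; rewrite !compA.
Qed.

(* Hom_D(F-, F-) *)
Definition hom_along (C D : category) (F : functor C D) :
    functor (prod_cat (op_cat C) C) type_cat :=
  hom_functor D ∘F prod_functor (op_functor F) F.

Program Definition fmap_nt (C D : category) (F : functor C D) :
    nat_trans (hom_functor C) (hom_along F) :=
  @NatTrans _ _ (hom_functor C) (hom_along F) (fun p f => fmap F f) _.
Next Obligation.
by move=> C D F x y f /=; apply: funext => h; rewrite !fmapM.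
Qed.

Definition separable (C D : category) (F : functor C D) : Prop :=
  exists P : nat_trans (hom_along F) (hom_functor C),
    P ∘N fmap_nt F = id_nt (hom_functor C).

Definition semiseparable (C D : category) (F : functor C D) : Prop :=
  exists P : nat_trans (hom_along F) (hom_functor C),
    fmap_nt F ∘N P ∘N fmap_nt F = fmap_nt F.

Definition endo_id (C : category) : Type :=
  nat_trans (id_functor C) (id_functor C).

(* The second clause is Fe = Id_F, stated componentwise because F ∘F id_functor C
   and F are not convertible. *)
Definition is_associated_idempotent (C D : category) (F : functor C D)
    (e : endo_id C) : Prop :=
  [/\ e ∘N e = e,
      forall X : C, fmap F (e X) = idm (F X)
    & forall (A B : C) (f g : hom A B),
        fmap F f = fmap F g <-> e B ∘ f = e B ∘ g].

Lemma associated_idempotent_exists (C D : category) (F : functor C D) :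
  semiseparable F -> exists e, is_associated_idempotent F e.
Proof.
case=> P hP.
have FPF (A B : C) (f : hom A B) : fmap F (P (A, B) (fmap F f)) = fmap F f.
  exact: (congr1 (fun t : nat_trans (hom_functor C) (hom_along F) => t (A, B) f) hP).
have natP (A B A' B' : C) (u : hom A' A) (v : hom B B') (f : hom (F A) (F B)) :
    P (A', B') (fmap F v ∘ f ∘ fmap F u) = v ∘ P (A, B) f ∘ u.
  pose w : @hom (prod_cat (op_cat C) C) (A, B) (A', B') := (u, v).
  exact: (congr1 (fun t => t f) (naturality P w)).
have natl (A B B' : C) (v : hom B B') (f : hom (F A) (F B)) :
    P (A, B') (fmap F v ∘ f) = v ∘ P (A, B) f.
  by have := natP _ _ _ _ (idm A) v f; rewrite fmap1 !compm1.
have natr (A B A' : C) (u : hom A' A) (f : hom (F A) (F B)) :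
    P (A', B) (f ∘ fmap F u) = P (A, B) f ∘ u.
  by have := natP _ _ _ _ u (idm B) f; rewrite fmap1 !comp1m.
pose c (X : C) : hom X X := P (X, X) (idm (F X)).
have cl (X Y : C) (f : hom X Y) : c Y ∘ f = P (X, Y) (fmap F f).
  by rewrite -natr comp1m.
have cr (X Y : C) (f : hom X Y) : f ∘ c X = P (X, Y) (fmap F f).
  by rewrite -natl compm1.
have Fc X : fmap F (c X) = idm (F X) by rewrite /c -fmap1 FPF.
have nat_c (x y : C) (f : hom x y) :
    c y ∘ fmap (id_functor C) f = fmap (id_functor C) f ∘ c x.
  by rewrite /= cl cr.
exists (@NatTrans C C (id_functor C) (id_functor C) c nat_c); split=> //=.
  by apply: nat_trans_eq => X /=; rewrite cl Fc.
move=> A B f g; rewrite !cl; split=> [-> //|h].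
by rewrite -FPF h FPF.
Qed.

Lemma associated_idempotent_unique (C D : category) (F : functor C D) e e' :
  is_associated_idempotent F e -> is_associated_idempotent F e' -> e = e'.
Proof.
case=> [_ Fe he] [_ Fe' he']; apply: nat_trans_eq => X.
have h1 : e' X ∘ e X = e' X ∘ idm X by apply/he'; rewrite Fe fmap1.
have h2 : e X ∘ e' X = e X ∘ idm X by apply/he; rewrite Fe' fmap1.
rewrite !compm1 in h1 h2.
by rewrite -h2 -[RHS]h1; apply: (naturality e (e' X)).
Qed.

Definition associated_idempotent (C D : category) (F : functor C D)
    (hF : semiseparable F) : endo_id C :=
  projT1 (cid (associated_idempotent_exists hF)).

Lemma associated_idempotentP (C D : category) (F : functor C D)
    (hF : semiseparable F) :
  is_associated_idempotent F (associated_idempotent hF).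
Proof. exact: projT2 (cid (associated_idempotent_exists hF)). Qed.

Lemma associated_idempotentE (C D : category) (F : functor C D)
    (hF : semiseparable F) (P : nat_trans (hom_along F) (hom_functor C)) :
  fmap_nt F ∘N P ∘N fmap_nt F = fmap_nt F ->
  forall X, associated_idempotent hF X = P (X, X) (idm (F X)).
Proof.
move=> hP X; have [_ Fe he] := associated_idempotentP hF.
have FP : fmap F (P (X, X) (idm (F X))) = idm (F X).
  have := congr1 (fun t : nat_trans (hom_functor C) (hom_along F) => t (X, X) (idm X)) hP.
  by rewrite /= fmap1.
have h : associated_idempotent hF X ∘ P (X, X) (idm (F X))
       = associated_idempotent hF X ∘ idm X by apply/he; rewrite FP fmap1.
rewrite compm1 in h.
pose w : @hom (prod_cat (op_cat C) C) (X, X) (X, X) :=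
  (idm X, associated_idempotent hF X).
have := congr1 (fun t => t (idm (F X))) (naturality P w).
by rewrite /= Fe fmap1 !compm1 h.
Qed.

Definition splits (C : category) (e : endo_id C) : Prop :=
  exists (P : functor C C) (pi : nat_trans (id_functor C) P)
         (iota : nat_trans P (id_functor C)),
    iota ∘N pi = e /\ pi ∘N iota = id_nt P.

Section Coidentifier.
Context (C : category) (e : endo_id C).

(* {classic _} provides the choice structure that {eq_quot _} requires. *)
Definition coid_rel (A B : C) (f g : {classic hom A B}) : bool :=
  `[< e B ∘ f = e B ∘ g >].

Lemma coid_rel_refl A B : reflexive (@coid_rel A B).
Proof. by move=> f; apply/asboolP. Qed.

Lemma coid_rel_sym A B : symmetric (@coid_rel A B).
Proof. by move=> f g; apply/asboolP/asboolP. Qed.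

Lemma coid_rel_trans A B : transitive (@coid_rel A B).
Proof.
by move=> g f h /asboolP fg /asboolP gh; apply/asboolP; rewrite fg.
Qed.

Canonical coid_equiv A B :=
  EquivRel (@coid_rel A B) (@coid_rel_refl A B) (@coid_rel_sym A B)
    (@coid_rel_trans A B).

Definition coid_hom (A B : C) : Type := {eq_quot @coid_rel A B}.

Definition coid_class (A B : C) (f : hom A B) : coid_hom A B :=
  (\pi_{eq_quot @coid_rel A B} (f : {classic hom A B}))%qT.

Definition coid_repr (A B : C) (c : coid_hom A B) : hom A B :=
  repr (c : {eq_quot @coid_rel A B}).

Lemma coid_classP A B (f g : hom A B) :
  coid_class f = coid_class g <-> e B ∘ f = e B ∘ g.
Proof.
split=> [/eqmodP/asboolP //|h]; apply/eqmodP; exact/asboolP.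
Qed.

Lemma coid_reprK A B (c : coid_hom A B) : coid_class (coid_repr c) = c.
Proof. exact: reprK. Qed.

Lemma coid_repr_class A B (f : hom A B) :
  e B ∘ coid_repr (coid_class f) = e B ∘ f.
Proof. by apply/coid_classP; rewrite coid_reprK. Qed.

Definition coid_comp (X Y Z : C) (g : coid_hom Y Z) (f : coid_hom X Y) :
    coid_hom X Z := coid_class (coid_repr g ∘ coid_repr f).

Lemma coid_compE X Y Z (g : hom Y Z) (f : hom X Y) :
  coid_comp (coid_class g) (coid_class f) = coid_class (g ∘ f).
Proof.
have nat_e (A B : C) (h : hom A B) : e B ∘ h = h ∘ e A := naturality e h.
apply/coid_classP; rewrite !compA coid_repr_class nat_e -!compA.
by rewrite coid_repr_class !compA.
Qed.

Program Definition coidentifier : category :=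
  @Category C coid_hom (fun X => coid_class (idm X)) coid_comp _ _ _.
Next Obligation.
move=> x y z w h g f; rewrite -[h]coid_reprK -[g]coid_reprK -[f]coid_reprK.
by rewrite !coid_compE compA.
Qed.
Next Obligation.
by move=> x y f; rewrite -[f]coid_reprK coid_compE comp1m.
Qed.
Next Obligation.
by move=> x y f; rewrite -[f]coid_reprK coid_compE compm1.
Qed.

Program Definition coid_proj : functor C coidentifier :=
  @Functor C coidentifier (fun X => X) coid_class _ _.
Next Obligation. by move=> * /=; rewrite coid_compE. Qed.

Lemma coid_proj_cancel (D : category) (K K' : functor coidentifier D) :
  K ∘F coid_proj = K' ∘F coid_proj -> K = K'.
Proof.
pose ok (G : functor C D) := forall (A B : C) (f g : hom A B),
  coid_class f = coid_class g -> fmap G f = fmap G g.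
have p1 (G : functor C D) (h : ok G) (X : C) :
    fmap G (coid_repr (coid_class (idm X))) = idm (G X).
  by rewrite -fmap1; apply: h; rewrite coid_reprK.
have pM (G : functor C D) (h : ok G) (X Y Z : C)
    (g : coid_hom Y Z) (f : coid_hom X Y) :
    fmap G (coid_repr (coid_comp g f))
    = fmap G (coid_repr g) ∘ fmap G (coid_repr f).
  by rewrite -fmapM; apply: h; rewrite coid_reprK.
pose rebuild (G : functor C D) (h : ok G) := @Functor coidentifier D G
  (fun A B c => fmap G (@coid_repr A B c)) (@p1 G h) (@pM G h).
have okK (L : functor coidentifier D) : ok (L ∘F coid_proj).
  by move=> A B f g /= ->.
have rebuildK L : rebuild (L ∘F coid_proj) (okK L) = L.
  by apply: functor_eq => A B c /=; rewrite coid_reprK.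
move=> E; rewrite -(rebuildK K) -(rebuildK K').
move: (okK K) (okK K') E; move: (K ∘F coid_proj) (K' ∘F coid_proj) => G G' h h' E; subst G'.
by rewrite (Prop_irrelevance h h').
Qed.

End Coidentifier.

Section CoidentifierLift.
Context (C D : category) (F : functor C D) (hF : semiseparable F).
Let e := associated_idempotent hF.

Lemma fmap_coid_repr (A B : C) (f : hom A B) :
  fmap F (coid_repr (coid_class e f)) = fmap F f.
Proof.
have [_ _ he] := associated_idempotentP hF.
by apply/he; rewrite coid_repr_class.
Qed.

(* The functor F_e, as shown by [coid_lift_proj] and [coid_lift_unique] below;
   it does not depend on the chosen representatives by [fmap_coid_repr]. *)
Program Definition coid_lift : functor (coidentifier e) D :=
  @Functor (coidentifier e) D F (fun A B c => fmap F (coid_repr c)) _ _.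
Next Obligation. by move=> X; apply: etrans (fmap_coid_repr _) (fmap1 _ _). Qed.
Next Obligation. by move=> X Y Z g f; apply: etrans (fmap_coid_repr _) (fmapM _ _ _). Qed.

Lemma coid_lift_fmap (A B : C) (f : hom A B) :
  fmap coid_lift (fmap (coid_proj e) f) = fmap F f.
Proof. exact: fmap_coid_repr. Qed.

Lemma coid_lift_proj : coid_lift ∘F coid_proj e = F.
Proof. by apply: functor_eq => A B f; apply: fmap_coid_repr. Qed.

Lemma coid_lift_unique (K : functor (coidentifier e) D) :
  K ∘F coid_proj e = F -> K = coid_lift.
Proof. by rewrite -coid_lift_proj => /coid_proj_cancel. Qed.

End CoidentifierLift.

(* [adjunction L G] : L is left adjoint to G. *)
Record adjunction (C D : category) (L : functor C D) (G : functor D C) :=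
  Adjunction {
    adj_unit : nat_trans (id_functor C) (G ∘F L);
    adj_counit : nat_trans (L ∘F G) (id_functor D);
    adj_triangleL : forall X : C,
      adj_counit (L X) ∘ fmap L (adj_unit X) = idm (L X);
    adj_triangleR : forall Y : D,
      fmap G (adj_counit Y) ∘ adj_unit (G Y) = idm (G Y) }.

Definition fully_faithful (C D : category) (F : functor C D) : Prop :=
  forall X Y : C, bijective (fun f : hom X Y => fmap F f).

Definition bireflection (C D : category) (G : functor D C) : Prop :=
  exists (L : functor C D) (LG : adjunction L G) (GL : adjunction G L),
    fully_faithful L /\
    adj_unit GL ∘N adj_counit LG = id_nt (L ∘F G).

Definition naturally_isomorphic (C D : category) (F G : functor C D) : Prop :=
  exists (a : nat_trans F G) (b : nat_trans G F),
    b ∘N a = id_nt F /\ a ∘N b = id_nt G.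

Definition is_equivalence (C D : category) (F : functor C D) : Prop :=
  exists G : functor D C,
    naturally_isomorphic (id_functor C) (G ∘F F) /\
    naturally_isomorphic (F ∘F G) (id_functor D).

(* Main.v *)
(** For a bireflection [N] with adjoint [L], counit [ε : LN -> Id] and unit
    [γ : Id -> LN], the coherence [γ ∘ ε = Id] makes [e = ε ∘ γ] an idempotent
    split by [LN], and [N e = Id] because [N ε] is split on both sides.  Hence
    [u |-> ε ∘ L (P^S u) ∘ γ] witnesses semiseparability of [S ∘ N], with
    associated idempotent [e].  Conversely, a splitting [e = ι ∘ π] through [P]
    makes [P] factor through the coidentifier as a functor [L], and
    [H : C -> C_e] is a bireflection with adjoint [L], both adjunctions having
    [π] as unit and [ι] as counit; [F_e] is separable by composing [P^F] with
    the projection.  Finally [H ∘ L] is a quasi-inverse of [N_e]: [ε] and [γ]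
    become mutually inverse in [C_e], and [Id -> NL] is invertible since [L] is
    fully faithful. *)
From mathcomp Require Import all_boot boolp.
Require Import Defs.
Local Open Scope cat_scope.

Set Implicit Arguments.
Unset Strict Implicit.
Unset Printing Implicit Defensive.

Lemma nat_endo (C : category) (e : endo_id C) (A B : C) (f : hom A B) :
  e B ∘ f = f ∘ e A.
Proof. exact: (naturality e f). Qed.

Lemma comp_ntE (C D : category) (F G H : functor C D) (b : nat_trans G H)
    (a : nat_trans F G) (c : nat_trans F H) (X : C) :
  b ∘N a = c -> b X ∘ a X = c X.
Proof. by move=> <-. Qed.

(** * Retractions on hom-sets *)

(** Naturality in both variables at once, freed from the product category, so that retractions can
    be handled as plain families of maps. *)
Definition hom_natural (C D : category) (F : functor C D)
    (p : forall A B : C, hom (F A) (F B) -> hom A B) : Prop :=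
  forall (A B A' B' : C) (u : hom A' A) (v : hom B B') (f : hom (F A) (F B)),
    p A' B' (fmap F v ∘ f ∘ fmap F u) = v ∘ p A B f ∘ u.

Lemma hom_natural_nt (C D : category) (F : functor C D) (p : _) :
  @hom_natural C D F p ->
  exists P : nat_trans (hom_along F) (hom_functor C),
    forall (A B : C) (f : hom (F A) (F B)), P (A, B) f = p A B f.
Proof.
move=> np.
have nP (x y : prod_cat (op_cat C) C) (f : hom x y) :
    @comp type_cat (hom_along F x) (hom_along F y) (hom_functor C y)
      (p y.1 y.2) (fmap (hom_along F) f)
    = @comp type_cat (hom_along F x) (hom_functor C x) (hom_functor C y)
      (fmap (hom_functor C) f) (p x.1 x.2).
  by apply: functional_extensionality_dep => h; apply: np.
by exists (@NatTrans _ _ (hom_along F) (hom_functor C)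
  (fun x => p x.1 x.2) nP).
Qed.

Lemma nt_hom_natural (C D : category) (F : functor C D)
    (P : nat_trans (hom_along F) (hom_functor C)) :
  @hom_natural C D F (fun A B f => P (A, B) f).
Proof.
move=> A B A' B' u v f.
pose w : @hom (prod_cat (op_cat C) C) (A, B) (A', B') := (u, v).
exact: (congr1 (fun t => t f) (naturality P w)).
Qed.

Lemma separableP (C D : category) (F : functor C D) :
  separable F <->
  exists2 p, @hom_natural C D F p &
    forall (A B : C) (f : hom A B), p A B (fmap F f) = f.
Proof.
split=> [[P hP]|[p /hom_natural_nt[P PE] pF]].
  exists (fun A B f => P (A, B) f) => [|A B f]; first exact: nt_hom_natural.
  exact: (congr1 (fun t : nat_trans (hom_functor C) (hom_functor C) =>
                    t (A, B) f) hP).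
exists P; apply: nat_trans_eq => -[A B].
by apply: functional_extensionality_dep => f /=; rewrite PE pF.
Qed.

Lemma semiseparableP (C D : category) (F : functor C D) :
  semiseparable F <->
  exists2 p, @hom_natural C D F p &
    forall (A B : C) (f : hom A B), fmap F (p A B (fmap F f)) = fmap F f.
Proof.
split=> [[P hP]|[p /hom_natural_nt[P PE] pF]].
  exists (fun A B f => P (A, B) f) => [|A B f]; first exact: nt_hom_natural.
  exact: (congr1 (fun t : nat_trans (hom_functor C) (hom_along F) =>
                    t (A, B) f) hP).
exists P; apply: nat_trans_eq => -[A B].
by apply: functional_extensionality_dep => f /=; rewrite PE pF.
Qed.

Lemma separable_faithful (C D : category) (F : functor C D) (A B : C)
    (f g : hom A B) :
  separable F -> fmap F f = fmap F g -> f = g.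
Proof. by case/separableP=> p _ pF fg; rewrite -(pF _ _ f) fg pF. Qed.

Lemma nat_iso_of_components (C D : category) (F G : functor C D)
    (a : forall X : C, hom (F X) (G X)) (b : forall X : C, hom (G X) (F X)) :
  (forall X, b X ∘ a X = idm (F X)) -> (forall X, a X ∘ b X = idm (G X)) ->
  (forall (X Y : C) (f : hom X Y), a Y ∘ fmap F f = fmap G f ∘ a X) ->
  naturally_isomorphic F G.
Proof.
move=> ba ab na.
(* Inverse components inherit naturality: conjugate the square of [a] by [b]. *)
have nb X Y (f : hom X Y) : b Y ∘ fmap G f = fmap F f ∘ b X.
  rewrite -[LHS]compm1 -ab !compA -(compA (b Y)) -na.
  by rewrite compA ba comp1m.
by exists (NatTrans na), (NatTrans nb); split; apply: nat_trans_eq => X /=.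
Qed.

(** The inverse is the preimage under [L] of the counit at [L X]. One composite is checked after
    applying the faithful [L], the other by naturality of the unit; each reduces to a triangle
    identity. *)
Lemma fully_faithful_unit_iso (C D : category) (L : functor C D)
    (G : functor D C) (adj : adjunction L G) (X : C) :
  fully_faithful L ->
  exists t : hom (G (L X)) X,
    t ∘ adj_unit adj X = idm X /\ adj_unit adj X ∘ t = idm (G (L X)).
Proof.
move=> ffL.
have [k _ gK] := ffL (G (L X)) X.
exists (k (adj_counit adj (L X))); split.
  apply: (bij_inj (ffL X X)).
  by rewrite /= fmapM gK adj_triangleL fmap1.
have := naturality (adj_unit adj) (k (adj_counit adj (L X))) => /= ->.
by rewrite gK adj_triangleR.
Qed.

(** * Functors out of the coidentifier *)

Section Descent.
Context (C D : category) (e : endo_id C) (G : functor C D).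
Hypothesis Ge : forall (A B : C) (f g : hom A B),
  e B ∘ f = e B ∘ g -> fmap G f = fmap G g.

Lemma fmap_repr (A B : C) (f : hom A B) :
  fmap G (coid_repr (coid_class e f)) = fmap G f.
Proof. by apply: Ge; rewrite coid_repr_class. Qed.

Lemma descend1 (A : C) : fmap G (coid_repr (@idm (coidentifier e) A)) = idm (G A).
Proof. by rewrite /= fmap_repr fmap1. Qed.

Lemma descendM (X Y Z : coidentifier e) (g : hom Y Z) (f : hom X Y) :
  fmap G (coid_repr (g ∘ f)) = fmap G (coid_repr g) ∘ fmap G (coid_repr f).
Proof. by rewrite /= fmap_repr fmapM. Qed.

(** Used with [P] to obtain the adjoint of the quotient functor, and with [N] to obtain the
    comparison functor. *)
Definition descend : functor (coidentifier e) D :=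
  @Functor (coidentifier e) D G (fun A B c => fmap G (coid_repr c))
    descend1 descendM.

Lemma descend_proj : descend ∘F coid_proj e = G.
Proof. by apply: functor_eq => A B f; apply: fmap_repr. Qed.

End Descent.

Lemma coid_proj_eq (C : category) (e : endo_id C) (A B : C) (f g : hom A B) :
  fmap (coid_proj e) f = fmap (coid_proj e) g <-> e B ∘ f = e B ∘ g.
Proof. exact: coid_classP. Qed.

Lemma coid_proj_full (C : category) (e : endo_id C) (A B : C)
    (c : @hom (coidentifier e) A B) :
  exists f : @hom C A B, c = fmap (coid_proj e) f.
Proof. by exists (coid_repr c); rewrite /= coid_reprK. Qed.

(** The semiseparability equation [F (p (F f)) = F f] says exactly that [p (F f)] and [f] have the
    same class. *)
Lemma coid_lift_separable (C D : category) (F : functor C D)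
    (hF : semiseparable F) : separable (coid_lift hF).
Proof.
have /semiseparableP[p np FpF] := hF.
have [_ _ he] := associated_idempotentP hF.
apply/separableP.
exists (fun (A B : coidentifier _) f =>
          fmap (coid_proj (associated_idempotent hF)) (p A B f)).
  move=> A B A' B' u v f.
  have [u' ->] := coid_proj_full u; have [v' ->] := coid_proj_full v.
  by rewrite !coid_lift_fmap np !fmapM.
move=> A B c; have [f ->] := coid_proj_full c.
by rewrite coid_lift_fmap; apply/coid_proj_eq/he.
Qed.

(** * The quotient functor of a split idempotent *)

Section SplitQuotient.
Context (C : category) (e : endo_id C) (P : functor C C).
Context (pi : nat_trans (id_functor C) P) (iota : nat_trans P (id_functor C)).
Hypotheses (iota_pi : forall X : C, iota X ∘ pi X = e X)
           (pi_iota : forall X : C, pi X ∘ iota X = idm (P X)).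

Let H := coid_proj e.

Lemma pi_nat (X Y : C) (f : hom X Y) : pi Y ∘ f = fmap P f ∘ pi X.
Proof. exact: (naturality pi f). Qed.

Lemma iota_nat (X Y : C) (f : hom X Y) : iota Y ∘ fmap P f = f ∘ iota X.
Proof. exact: (naturality iota f). Qed.

Lemma split_fmapE (X Y : C) (f : hom X Y) : fmap P f = pi Y ∘ f ∘ iota X.
Proof. by rewrite pi_nat -compA pi_iota compm1. Qed.

Lemma split_idem (X : C) : e X ∘ e X = e X.
Proof. by rewrite -iota_pi compA -(compA _ (pi X)) pi_iota compm1. Qed.

(** Since [pi] absorbs [e], the formula [P f = pi ∘ f ∘ iota] depends on [e ∘ f] only. *)
Lemma fmap_split (A B : C) (f g : hom A B) :
  e B ∘ f = e B ∘ g -> fmap P f = fmap P g.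
Proof.
move=> fg; have pie : pi B = pi B ∘ e B by rewrite -iota_pi compA pi_iota comp1m.
by rewrite !split_fmapE pie -!(compA (pi B)) fg.
Qed.

Let L := descend fmap_split.

Lemma proj_e (X : C) : fmap H (e X) = idm (H X).
Proof. by rewrite -fmap1; apply/coid_proj_eq; rewrite split_idem compm1. Qed.

(** This and the next two lemmas give the triangle identities of both adjunctions; the middle one
    serves each of them. *)
Lemma iota_L (X : C) : iota (P X) ∘ fmap P (pi X) = idm (P X).
Proof. by rewrite iota_nat pi_iota. Qed.

Lemma proj_iota_pi (X : C) : fmap H (iota X) ∘ fmap H (pi X) = idm (H X).
Proof. by rewrite -fmapM iota_pi proj_e. Qed.

Lemma fmap_iota_pi (X : C) : fmap P (iota X) ∘ pi (P X) = idm (P X).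
Proof. by rewrite -pi_nat pi_iota. Qed.

Lemma unit_HL_nat (X Y : coidentifier e) (f : hom X Y) :
  fmap H (pi Y) ∘ fmap (id_functor _) f = fmap (H ∘F L) f ∘ fmap H (pi X).
Proof.
have [g ->] := coid_proj_full f.
have -> : fmap (H ∘F L) (fmap H g) = fmap H (fmap P g) by rewrite /= (fmap_repr fmap_split).
apply: etrans (esym (fmapM H (pi Y) g)) _.
by rewrite pi_nat; apply: (fmapM H (fmap P g) (pi X)).
Qed.

Lemma counit_HL_nat (X Y : coidentifier e) (f : hom X Y) :
  fmap H (iota Y) ∘ fmap (H ∘F L) f = fmap (id_functor _) f ∘ fmap H (iota X).
Proof.
have [g ->] := coid_proj_full f.
have -> : fmap (H ∘F L) (fmap H g) = fmap H (fmap P g) by rewrite /= (fmap_repr fmap_split).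
apply: etrans (esym (fmapM H (iota Y) (fmap P g))) _.
by rewrite iota_nat; apply: (fmapM H g (iota X)).
Qed.

Lemma unit_LH_nat (X Y : C) (f : hom X Y) :
  pi Y ∘ fmap (id_functor C) f = fmap (L ∘F H) f ∘ pi X.
Proof. by rewrite /= (fmap_repr fmap_split) pi_nat. Qed.

Lemma counit_LH_nat (X Y : C) (f : hom X Y) :
  iota Y ∘ fmap (L ∘F H) f = fmap (id_functor C) f ∘ iota X.
Proof. by rewrite /= (fmap_repr fmap_split) iota_nat. Qed.

(** The counit is recorded because coherence composes it with the unit of the opposite adjunction,
    recorded in [split_adj_HL]. *)
Lemma split_adj_LH : exists LH : adjunction L H,
  forall X : C, adj_counit LH X = iota X.
Proof.
have tL (X : coidentifier e) : iota (L X) ∘ fmap L (fmap H (pi X)) = idm (L X).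
  by rewrite /= (fmap_repr fmap_split) iota_L.
have tR (X : C) : fmap H (iota X) ∘ fmap H (pi X) = idm (H X).
  exact: proj_iota_pi.
by exists (@Adjunction _ _ L H
  (@NatTrans _ _ (id_functor _) (H ∘F L) (fun X => fmap H (pi X)) unit_HL_nat)
  (@NatTrans _ _ (L ∘F H) (id_functor _) (fun X => iota X) counit_LH_nat)
  tL tR).
Qed.

Lemma split_adj_HL : exists HL : adjunction H L,
  forall X : C, adj_unit HL X = pi X.
Proof.
have tL (X : C) : fmap H (iota X) ∘ fmap H (pi X) = idm (H X).
  exact: proj_iota_pi.
have tR (X : coidentifier e) : fmap L (fmap H (iota X)) ∘ pi (L X) = idm (L X).
  by rewrite /= (fmap_repr fmap_split) fmap_iota_pi.
by exists (@Adjunction _ _ H L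
  (@NatTrans _ _ (id_functor _) (L ∘F H) (fun X => pi X) unit_LH_nat)
  (@NatTrans _ _ (H ∘F L) (id_functor _) (fun X => fmap H (iota X))
    counit_HL_nat)
  tL tR).
Qed.

Lemma split_fully_faithful : fully_faithful L.
Proof.
(* The inverse conjugates back by the splitting: [P g] returns to [e ∘ g], which has the class of
   [g]. *)
move=> X Y; exists (fun h : hom (P X) (P Y) => fmap H (iota Y ∘ h ∘ pi X)).
  move=> f; have [g ->] := coid_proj_full f.
  apply/coid_proj_eq; rewrite /= (fmap_repr fmap_split) iota_nat -compA iota_pi.
  by rewrite -nat_endo compA split_idem.
move=> h; rewrite /= (fmap_repr fmap_split) split_fmapE -(compA (iota Y)) compA pi_iota.
by rewrite comp1m -compA pi_iota compm1.
Qed.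

Lemma coid_proj_bireflection : bireflection H.
Proof.
have [LH eLH] := split_adj_LH; have [HL eHL] := split_adj_HL.
exists L, LH, HL; split; first exact: split_fully_faithful.
by apply: nat_trans_eq => X /=; rewrite eLH eHL pi_iota.
Qed.

End SplitQuotient.

(** * Composing a bireflection with a separable functor *)

Section Factorization.
Context (C E D : category) (N : functor C E) (S : functor E D).
Context (L : functor E C) (LN : adjunction L N) (NL : adjunction N L).
Hypothesis ffL : fully_faithful L.
Hypothesis coh : adj_unit NL ∘N adj_counit LN = id_nt (L ∘F N).
Hypothesis sepS : separable S.

Local Notation eps := (adj_counit LN).
Local Notation gam := (adj_unit NL).

Lemma eps_nat (X Y : C) (f : hom X Y) :
  eps Y ∘ fmap L (fmap N f) = f ∘ eps X.
Proof. exact: (naturality eps f). Qed.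

Lemma gam_nat (X Y : C) (f : hom X Y) :
  gam Y ∘ f = fmap L (fmap N f) ∘ gam X.
Proof. exact: (naturality gam f). Qed.

Lemma gam_eps (X : C) : gam X ∘ eps X = idm (L (N X)).
Proof. exact: (comp_ntE X coh). Qed.

(** Coherence makes [b] a left inverse of [a], and a triangle identity gives [a] a right inverse;
    hence [b] is a two-sided inverse. *)
Lemma fmap_eps_gam (X : C) : fmap N (eps X) ∘ fmap N (gam X) = idm (N X).
Proof.
set a := fmap N (eps X); set b := fmap N (gam X).
have ba : b ∘ a = idm _ by rewrite -fmapM gam_eps fmap1.
have ac : a ∘ adj_unit LN (N X) = idm (N X) by rewrite adj_triangleR.
by rewrite -[LHS]compm1 -ac compA -(compA a) ba compm1.
Qed.

(** Evaluates the semiseparability witness on the image of [f]: it composes [f] with [eps ∘ gam]. *)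
Lemma eps_LN_gam (X Y : C) (f : hom X Y) :
  eps Y ∘ fmap L (fmap N f) ∘ gam X = eps Y ∘ gam Y ∘ f.
Proof. by rewrite -compA -gam_nat compA. Qed.

Lemma factorization_semiseparable : semiseparable (S ∘F N).
Proof.
have /separableP[p np pS] := sepS; apply/semiseparableP.
exists (fun A B f => eps B ∘ fmap L (p (N A) (N B) f) ∘ gam A).
  move=> A B A' B' u v f /=.
  by rewrite np !fmapM !compA eps_nat -!compA -gam_nat.
by move=> A B f /=; rewrite pS eps_LN_gam !(fmapM N) fmap_eps_gam comp1m.
Qed.

Lemma factorization_idempotentE (hF : semiseparable (S ∘F N)) :
  associated_idempotent hF = adj_counit LN ∘N adj_unit NL.
Proof.
(* By uniqueness it suffices that [eps ∘ gam] satisfies the three defining clauses. *)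
apply: associated_idempotent_unique (associated_idempotentP hF) _.
split.
- apply: nat_trans_eq => X /=.
  by rewrite compA -(compA (eps X)) gam_eps compm1.
- by move=> X /=; rewrite fmapM fmap_eps_gam fmap1.
move=> A B f g /=; split=> [/(separable_faithful sepS) fg|h].
  by rewrite -!eps_LN_gam fg.
have := congr1 (fun k => fmap N k) h.
by rewrite !fmapM fmap_eps_gam !comp1m => ->.
Qed.

(** * The comparison functor out of the coidentifier *)

Section Comparison.
Context (hF : semiseparable (S ∘F N)).
Let e := associated_idempotent hF.
Let H := coid_proj e.

(** [S] is faithful, being separable, so [N] identifies every pair that [S ∘F N] does. *)
Lemma fmap_N_idempotent (A B : C) (f g : hom A B) :
  e B ∘ f = e B ∘ g -> fmap N f = fmap N g.
Proof.
have [_ _ he] := associated_idempotentP hF.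
by move=> /he /(separable_faithful sepS).
Qed.

Definition comparison : functor (coidentifier e) E := descend fmap_N_idempotent.

Lemma comparison_lift : S ∘F comparison = coid_lift hF.
Proof.
apply: coid_lift_unique; apply: (@functor_eq _ _ (S ∘F N)) => A B f /=.
by rewrite (fmap_repr fmap_N_idempotent).
Qed.

Lemma proj_eps_gam (X : C) : fmap H (eps X) ∘ fmap H (gam X) = idm (H X).
Proof.
rewrite -fmapM -(fmap1 H); apply/coid_proj_eq.
rewrite /e factorization_idempotentE /=.
by rewrite compA -(compA (eps X)) gam_eps !compm1.
Qed.

Lemma comparison_equivalence : is_equivalence comparison.
Proof.
exists (H ∘F L); split.
  apply: (@nat_iso_of_components _ _ (id_functor _) ((H ∘F L) ∘F comparison)
    (fun X : coidentifier e => fmap H (gam X)) (fun X => fmap H (eps X))) => [||X Y f].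
  - exact: proj_eps_gam.
  - move=> X; apply: etrans (esym (fmapM H (gam X) (eps X))) _.
    by rewrite gam_eps; apply: (fmap1 H).
  have [g ->] := coid_proj_full f.
  have -> : fmap ((H ∘F L) ∘F comparison) (fmap H g) = fmap H (fmap L (fmap N g)).
    by rewrite /= (fmap_repr fmap_N_idempotent).
  apply: etrans (esym (fmapM H (gam Y) g)) _.
  by rewrite gam_nat; apply: (fmapM H (fmap L (fmap N g)) (gam X)).
(* Choice turns the pointwise inverses of the unit into a family. *)
have ex X := fully_faithful_unit_iso LN X ffL.
have inv X := projT2 (cid (ex X)).
(* The unit of [LN] points from the identity to [N L], so the isomorphism is built in this direction
   and then reversed. *)
have [a [b [ab ba]]] : naturally_isomorphic (id_functor E) (comparison ∘F (H ∘F L)).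
  apply: (@nat_iso_of_components _ _ (id_functor _) (comparison ∘F (H ∘F L))
    (fun X => adj_unit LN X) (fun X => projT1 (cid (ex X)))) => [X|X|X Y f].
  - by case: (inv X).
  - by case: (inv X).
  rewrite [fmap (comparison ∘F _) _]/= (fmap_repr fmap_N_idempotent).
  exact: (naturality (adj_unit LN) f).
by exists b, a.
Qed.

End Comparison.
End Factorization.

Theorem corollary2p28 (C D : category) (F : functor C D) :
  ((exists (E : category) (N : functor C E) (S : functor E D),
      [/\ F = S ∘F N, bireflection N & separable S])
   <->
   (exists hF : semiseparable F, splits (associated_idempotent hF)))
  /\
  (forall (E : category) (N : functor C E) (S : functor E D),
     F = S ∘F N -> bireflection N -> separable S ->
     exists hF : semiseparable F,
     exists Ne : functor (coidentifier (associated_idempotent hF)) E,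
       unique (fun K : functor (coidentifier (associated_idempotent hF)) E =>
                 K ∘F coid_proj (associated_idempotent hF) = N /\
                 S ∘F K = coid_lift hF) Ne /\
       is_equivalence Ne).
Proof.
split; first split.
- case=> E [N [S [-> [L [LN [NL [_ coh]]]] sepS]]].
  exists (factorization_semiseparable coh sepS).
  (* Coherence is the second splitting equation. *)
  exists (L ∘F N), (adj_unit NL), (adj_counit LN); split=> //.
  by rewrite (factorization_idempotentE coh sepS).
- case=> hF [P [pi [iota [ip pi_i]]]].
  exists (coidentifier (associated_idempotent hF)), (coid_proj _), (coid_lift hF).
  split; [by rewrite coid_lift_proj | | exact: coid_lift_separable].
  apply: (@coid_proj_bireflection _ _ P pi iota) => X.
    exact: (comp_ntE X ip).
  exact: (comp_ntE X pi_i).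
move=> E N S -> [L [LN [NL [ffL coh]]]] sepS.
pose hF := factorization_semiseparable coh sepS.
have KN : comparison sepS hF ∘F coid_proj _ = N by exact: descend_proj.
exists hF, (comparison sepS hF); split; last exact: (comparison_equivalence ffL coh).
split; first by split; [exact: KN | exact: comparison_lift].
(* Functors out of the coidentifier that agree after the projection are equal. *)
by move=> K [KN' _]; apply: coid_proj_cancel; rewrite KN KN'.
Qed.
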